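(* Let $q\ge 2$ be an integer and let $T$ be the finite homogeneous tree of degree $q+1$ with root $0$ and $N\ge 1$ levels, viewed as an electric network with conductance $1$ on every edge, with its associated Markov chain. For a vertex $a$ and a set of vertices $Z$ with $a\notin Z$, let $P[a\to Z]$ be the probability that the chain started at $a$ reaches $Z$ before returning to $a$. Then, for $n\ge 1$: (a) if $N\ge n$ and $Z$ is the set of all vertices of level $n$, then $$P[0\to Z]=q^{n-1}\cdot\frac{q-1}{q^n-1};$$ (b) if $N=n$, $a$ is an arbitrary vertex of level $n$, and $Z$ is the union of the subtrees rooted in $0$ and not containing $a$, then $$P[a\to Z]=\frac1n;$$ (c) if $N>n$, $a$ is an arbitrary vertex of level $n$, and $Z$ is the union of the subtrees rooted in $0$ and not containing $a$, then $$P[a\to Z]=\frac{1}{n(q+1)};$$ (d) if $a$ is a terminal vertex and $x\neq a$ is an arbitrary vertex, then $$P[a\to x]=\frac{1}{d(a,x)};$$ (e) if $a$ is not a terminal vertex and $x\ne a$ is an arbitrary vertex, then $$P[a\to x]=\frac{1}{d(a,x)\,(q+1)}.$$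
   Context: The finite homogeneous tree of degree $q+1$ with $N$ levels is obtained from the infinite homogeneous tree (every vertex has exactly $q+1$ neighbours) with root $0$ by keeping only the vertices at distance at most $N$ from $0$; the level of a vertex is its distance to $0$, and $d(a,x)$ is the number of edges of the geodesic path from $a$ to $x$. Terminal vertices are those of level $N$ (they have exactly one neighbour); all other vertices have $q+1$ neighbours. The associated Markov chain $(X_n)_{n\ge0}$ is the simple random walk on this finite tree: from a vertex $x$ of level $<N$ it moves to each of the $q+1$ neighbours with probability $\frac{1}{q+1}$; from a vertex of level $N$ it moves to its unique neighbour with probability $1$. $P[a\to Z]=P_a(\tau_Z<T_a)$, where $\tau_Z=\inf\{n\ge 0: X_n\in Z\}$, $T_a=\inf\{n\ge 1: X_n=a\}$, and $P_a$ is the law of the chain started at $X_0=a$; $P[a\to x]$ means $P[a\to\{x\}]$. The subtrees rooted in $0$ are the $q+1$ subtrees, one for each neighbour $u$ of $0$, consisting of the root $0$ together with $u$ and all vertices whose geodesic path to $0$ passes through $u$. Thus in (b) and (c) the set $Z$ consists of $0$ and of all vertices of the $q$ such subtrees that do not contain $a$. *)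

(* Defs.v *)
From mathcomp Require Import all_boot all_order all_algebra.
From mathcomp Require Import all_classical all_reals all_analysis.

Set Implicit Arguments.
Unset Strict Implicit.
Unset Printing Implicit Defensive.

Import Order.TTheory GRing.Theory Num.Theory.

Local Open Scope classical_set_scope.
Local Open Scope ring_scope.

Section Tree.
Context {V : choiceType}.
Implicit Types (e : rel V) (x y o : V) (q N : nat).

(* Simple graph, connected, without cycles (a cycle of a simple graph has at
   least three vertices), in which every vertex has exactly q + 1 neighbours. *)
Record is_homogeneous_tree q e : Prop := {
  tree_sym : symmetric e;
  tree_irr : irreflexive e;
  tree_connected : forall x y, exists p, path e x p /\ last x p = y;
  tree_acyclic : forall c : seq V, ucycle e c -> (size c <= 2)%N;
  tree_degree : forall x, exists s : seq V,
    [/\ uniq s, size s = q.+1 & forall y, e x y = (y \in s)] }.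

(* The simple path from x to y, unique in a tree, without its first vertex x. *)
Definition geodesic e x y : seq V :=
  xget [::] [set p | [/\ path e x p, uniq (x :: p) & last x p = y]].

Definition tree_dist e x y : nat := size (geodesic e x y).

Definition finite_tree e o N : Type := {x : V | (tree_dist e o x <= N)%N}.

Lemma tree_dist_self_le e o N : (tree_dist e o o <= N)%N.
Proof.
rewrite /tree_dist /geodesic.
case: xgetP => // p _ [_ /= /andP[op _] po].
case: p op po => // u p op po.
by have := mem_last u p; rewrite [last u p]po (negPf op).
Qed.

End Tree.

Section FiniteTree.
Context {V : choiceType} {e : rel V} {o : V} {N : nat}.
Implicit Types x y u a : finite_tree e o N.

Definition tree_root : finite_tree e o N :=
  exist _ o (tree_dist_self_le e o N).

Definition adj x y : bool := e (val x) (val y).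

Definition dist x y : nat := tree_dist e (val x) (val y).

Definition level x : nat := dist tree_root x.

Definition terminal x : Prop := level x = N.

Definition subtree u : set (finite_tree e o N) :=
  [set x | x = tree_root \/ val u \in val x :: geodesic e (val x) o].

Definition other_subtrees a : set (finite_tree e o N) :=
  \bigcup_(u in [set u | adj tree_root u /\ ~ subtree u a]) subtree u.

(* c(x,y) / c(x) for unit conductances, where c(x) is q + 1 at an inner vertex
   and 1 at a terminal one. *)
Definition walk_transition (R : realType) (q : nat) x y : R :=
  if adj x y then (if (level x < N)%N then q.+1%:R^-1 else 1) else 0.

End FiniteTree.

Section MarkovChain.
Context {R : realType} {d : measure_display} {Omega : measurableType d}.
Context {S : Type}.
Implicit Types (X : nat -> Omega -> S) (Z : set S) (a : S).

(* X is, under P, a Markov chain with transition probabilities p and X_0 = a,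
   for a countable state space S. The Markov property
     P(X_(n+1) = x_(n+1) | X_0 = x_0, ..., X_n = x_n) = p(x_n, x_(n+1))
   is multiplied out by the probability of the conditioning event. *)
Record is_markov_chain (P : probability Omega R) X (p : S -> S -> R) a : Prop := {
  chain_measurable : forall n x, measurable (X n @^-1` [set x]);
  chain_start : P (X 0%N @^-1` [set a]) = 1%E;
  chain_step : forall n (x : nat -> S),
    P (\bigcap_(i in [set i | (i <= n.+1)%N]) (X i @^-1` [set x i])) =
    (P (\bigcap_(i in [set i | (i <= n)%N]) (X i @^-1` [set x i])) *
     (p (x n) (x n.+1))%:E)%E }.

(* inf {n >= m : X_n \in Z}, with value +oo if there is no such n. *)
Definition first_time_from (m : nat) X Z (w : Omega) : \bar R :=
  ereal_inf [set (n%:R)%:E | n in [set n | (m <= n)%N /\ Z (X n w)]].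

Definition hitting_time X Z := first_time_from 0 X Z.

Definition return_time X a := first_time_from 1 X [set a].

(* P[a -> Z], where P a is the law under which the chain X starts at a. *)
Definition reach_prob (P : S -> probability Omega R) X a Z : \bar R :=
  P a [set w | (hitting_time X Z w < return_time X a w)%E].

End MarkovChain.

(* Main.v *)
(* For a set Z and a function f with f(a) = 0, f = 1 on Z and f harmonic
   elsewhere, P[a -> Z] is the mean of f after one step from a: the mean of f
   along the chain killed in Z and in a is conserved, and the mass still alive
   tends to 0 because the walk admits a nonnegative function g decreasing by at
   least 1 on average at each step, here g(x) = r^M - r^(M - d(a, x)) with
   r = 2(q + 1) and M the maximum of d(a, .).

   In a tree all the neighbours of x <> a are at distance d(a, x) + 1 from a,
   except one at distance d(a, x) - 1, so the sum over the neighbours y of x of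
   d(a, y) - d(a, x) is deg(x) - 2 and does not depend on a. Hence
   f(x) = (d(a, b) + d(a, x) - d(b, x)) / (2 d(a, b)) is harmonic off a and b,
   with f(a) = 0 and f(b) = 1, and P[a -> b] = 1 / (d(a, b) deg(a)). With b the
   root, f is 1 on every subtree that does not contain a, since the geodesics
   from there to a pass through the root. For the levels,
   f(x) = (1 - q^(-k)) / (1 - q^(-n)) with k = min(level x, n). *)

Require Import Defs.
From mathcomp Require Import all_boot all_order all_algebra.
From mathcomp Require Import all_classical all_reals all_analysis.
From mathcomp Require Import ring lra.

Import Order.TTheory GRing.Theory Num.Theory.
Import numFieldNormedType.Exports.

Set Implicit Arguments.
Unset Strict Implicit.
Unset Printing Implicit Defensive.

Local Open Scope classical_set_scope.
Local Open Scope ring_scope.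

(** * Simple paths in a tree *)

Section SimplePaths.
Context {V : choiceType} {q : nat} {e : rel V} (he : is_homogeneous_tree q e).
Implicit Types (x y z a : V) (p : seq V).

Definition simple_path x p y := [/\ path e x p, uniq (x :: p) & last x p = y].

Lemma simple_path_rev x p y :
  simple_path x p y -> simple_path y (rev (belast x p)) x.
Proof.
move=> [px ux <-].
have E : last x p :: rev (belast x p) = rev (x :: p).
  by rewrite [in RHS]lastI rev_rcons.
split.
- by rewrite rev_path (eq_path (e' := e)) // => u v; rewrite (tree_sym he).
- by rewrite E rev_uniq.
- by case: {px ux E} p => //= z p; rewrite rev_cons last_rcons.
Qed.

Lemma simple_path_cat x p1 p2 y : simple_path x (p1 ++ p2) y ->
  simple_path x p1 (last x p1) /\ simple_path (last x p1) p2 y.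
Proof.
move=> [+ + <-]; rewrite cat_path last_cat => /andP[? ?].
rewrite -cat_cons cat_uniq => /and3P[u1 /hasPn h u2]; split; split=> //=.
rewrite u2 andbT; apply/negP => /h; rewrite mem_last //.
Qed.

(** Suppose the paths part at once, through [u] and [v], and let [w] be the first vertex of [u :: p]
    that lies on the other path. Going to [w] along one path and back along the other is a cycle, so
    acyclicity reduces both pieces to the single edge from [x] to [w], and [u = w = v]. *)
Lemma simple_path_unique x p p' y :
  simple_path x p y -> simple_path x p' y -> p = p'.
Proof.
elim: p x p' => [|u p IH] x [|v p'] //.
- by move=> [_ _ /= <-] [_ /= /andP[+ _] E]; rewrite -E mem_last.
- by move=> [_ /= /andP[+ _] E] [_ _ /= E']; rewrite E' -E mem_last.
move=> S S'; have [uv|uv] := eqVneq u v.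
  by rewrite -uv in S' *; congr cons; apply: (IH u);
    [have [] := @simple_path_cat x [:: u] p y S
    |have [] := @simple_path_cat x [:: u] p' y S'].
case: S S' => [P U L] [P' U' L'].
have hh : has (mem (v :: p')) (u :: p).
  apply/hasP; exists y.
    by rewrite -L /= mem_last.
  by rewrite -L' /= mem_last.
case Ep: _ _ _ / (split_find hh) => [w p1 p2 wp' /hasPn np1].
have [p1' [p2' Ep']] : exists p1' p2', v :: p' = rcons p1' w ++ p2'.
  have : w \in v :: p' by [].
  by case/path.splitP => p1' p2'; exists p1', p2'.
move: P U P' U'; rewrite Ep Ep' !cat_path.
move=> /andP[P _] U /andP[P' _] U'.
have U1 : uniq (x :: rcons p1 w).
  by move: U; rewrite -cat_cons cat_uniq => /and3P[].
have U1' : uniq (x :: rcons p1' w).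
  by move: U'; rewrite -cat_cons cat_uniq => /and3P[].
have /(tree_acyclic he) /= : ucycle e (x :: rcons p1 w ++ rev p1').
  apply/andP; split.
    rewrite /= rcons_cat cat_path P last_rcons /=.
    have /simple_path_rev[+ _ _] : simple_path x (rcons p1' w) w.
      by split => //; rewrite last_rcons.
    by rewrite belast_rcons rev_cons.
  rewrite -cat_cons cat_uniq U1 rev_uniq /=.
  move: U1'; rewrite /= mem_rcons inE negb_or rcons_uniq.
  move=> /and3P[/andP[_ xp] wp1 ->].
  rewrite andbT; apply/hasPn => z; rewrite mem_rev => zp.
  rewrite !inE mem_rcons inE !negb_or; apply/and3P; split.
  - by apply: contraNneq xp => <-.
  - by apply: contraNneq wp1 => <-.
  - apply/negP => /np1; rewrite Ep' /= mem_cat mem_rcons inE zp orbT //.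
rewrite size_cat size_rcons size_rev !addSn !ltnS leqn0 addn_eq0 !size_eq0.
move=> /andP[/eqP p10 /eqP p10']; move: Ep Ep' uv.
by rewrite p10 p10' /= => -[-> _] [-> _]; rewrite eqxx.
Qed.

(** * Geodesics, and how the distance to a fixed vertex changes along edges *)

Lemma geodesicP x y : simple_path x (geodesic e x y) y.
Proof.
rewrite /geodesic; case: xgetP => [p _ //|none].
have [p [ep Ly]] := tree_connected he x y.
by case/shortenP: ep Ly => p' ep' up' _ Ly; case: (none p').
Qed.

Lemma tree_distE x p y : simple_path x p y -> tree_dist e x y = size p.
Proof. by move=> /(simple_path_unique (geodesicP x y)) <-. Qed.

Lemma tree_distC x y : tree_dist e x y = tree_dist e y x.
Proof.
rewrite (tree_distE (simple_path_rev (geodesicP y x))).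
by rewrite size_rev size_belast.
Qed.

Lemma tree_distxx x : tree_dist e x x = 0%N.
Proof. by rewrite (@tree_distE x [::] x). Qed.

Lemma tree_dist_eq0 x y : (tree_dist e x y == 0%N) = (x == y).
Proof.
apply/eqP/eqP => [|->]; last exact: tree_distxx.
by move=> /size0nil E; have [_ _] := geodesicP x y; rewrite E.
Qed.

(** If [y] lies on the geodesic from [a] to [x], uniqueness makes the edge from [y] to [x] its last
    step; otherwise appending [y] to that geodesic keeps it simple. *)
Lemma tree_dist_adj a x y : e x y ->
  tree_dist e a y = (tree_dist e a x).+1 \/
  tree_dist e a x = (tree_dist e a y).+1.
Proof.
move=> exy; have S := geodesicP a x; have [P U L] := S.
have [yin|yNin] := boolP (y \in a :: geodesic e a x).
  right; case/path.splitPl: yin S => p1 p2 E S.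
  have := simple_path_cat S; rewrite E => -[S1 S2]; rewrite (tree_distE S1).
  have S3 : simple_path y [:: x] x.
    split=> //=; first by rewrite (tree_sym he) exy.
    by rewrite inE; case: eqVneq exy => // ->; rewrite (tree_irr he).
  by rewrite (tree_distE S) (simple_path_unique S2 S3) size_cat addn1.
left; rewrite (@tree_distE a (rcons (geodesic e a x) y) y) ?size_rcons //.
split; rewrite ?last_rcons //; first by rewrite rcons_path P L.
by rewrite -rcons_cons rcons_uniq yNin.
Qed.

Lemma tree_dist_adj1 x y : e x y -> tree_dist e x y = 1%N.
Proof.
by move=> /(tree_dist_adj x)[]; rewrite tree_distxx.
Qed.

Lemma simple_path_prefix_lt x p y z : simple_path x p y -> z \in x :: p ->
  z != y -> (tree_dist e x z < tree_dist e x y)%N.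
Proof.
move=> S zin zy; rewrite (tree_distE S).
case/path.splitPl: zin S => p1 p2 <- S in zy *.
have [S1 [_ _ L2]] := simple_path_cat S.
rewrite (tree_distE S1) size_cat -[ltnLHS]addn0 ltn_add2l lt0n size_eq0.
by apply: contraNneq zy => p20; rewrite -L2 p20.
Qed.

Lemma simple_path_rcons a x u : e x u ->
  (tree_dist e a u < tree_dist e a x)%N ->
  simple_path a (rcons (geodesic e a u) x) x.
Proof.
move=> exu ltux; have [P U L] := geodesicP a u.
split; rewrite ?last_rcons //; first by rewrite rcons_path P L (tree_sym he).
rewrite -rcons_cons rcons_uniq U andbT; apply: contraTN ltux => xin.
rewrite -leqNgt; have [->//|xu] := eqVneq x u.
exact/ltnW/(simple_path_prefix_lt (geodesicP a u)).
Qed.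

(** Appending [x] to the geodesics from [a] to [y] and to [z] gives two simple paths from [a] to
    [x], which coincide. *)
Lemma closer_adj_unique a x y z : e x y -> e x z ->
  (tree_dist e a y < tree_dist e a x)%N ->
  (tree_dist e a z < tree_dist e a x)%N -> y = z.
Proof.
move=> exy exz /(simple_path_rcons exy) Sy /(simple_path_rcons exz) Sz.
have /rcons_inj[E] := simple_path_unique Sy Sz.
by have [_ _ <-] := geodesicP a y; have [_ _ <-] := geodesicP a z; rewrite E.
Qed.

(** A simple path that has moved away from [a] never turns back: the only neighbour of [u] nearer to
    [a] is [x], already visited. *)
Lemma simple_path_away a x u p y : simple_path x (u :: p) y ->
  (tree_dist e a x < tree_dist e a u)%N ->
  tree_dist e a y = (tree_dist e a x + (size p).+1)%N.
Proof.
elim: p x u => [|v p IH] x u S lt_xu.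
  case: S => /= /andP[exu _] _ <-.
  case: (tree_dist_adj a exu) => [->|E]; first by rewrite addn1.
  by rewrite E ltnNge leqnSn in lt_xu.
have [_ S'] := @simple_path_cat x [:: u] (v :: p) y S.
case: S => /= /and3P[exu euv _] /and3P[xN _ _] _.
have dxu : tree_dist e a u = (tree_dist e a x).+1.
  by case: (tree_dist_adj a exu) => // E; rewrite E ltnNge leqnSn in lt_xu.
rewrite (IH _ _ S') ?dxu ?addSnnS //=; rewrite -dxu.
case: (tree_dist_adj a euv) => [->//|E].
have /= Exv : x = v.
  apply: (closer_adj_unique (a := a) (x := u)) => //; rewrite ?E //.
  by rewrite (tree_sym he).
by move: xN; rewrite Exv !inE eqxx orbT.
Qed.

(** This turns membership in a subtree rooted in [o] into a comparison of distances. *)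
Lemma mem_geodesic_adj a o u : e o u ->
  (u \in a :: geodesic e a o) = (tree_dist e a u < tree_dist e a o)%N.
Proof.
move=> eou; apply/idP/idP => [uin|/(simple_path_rcons eou) S].
  apply: (simple_path_prefix_lt (geodesicP a o)) => //.
  by apply: contraTneq eou => ->; rewrite (tree_irr he).
rewrite (simple_path_unique (geodesicP a o) S) -rcons_cons mem_rcons inE.
by have [_ _ L] := geodesicP a u; rewrite -{2}L mem_last orbT.
Qed.

(** The geodesic from [o] to [y] starts with [u], a step away from [a], so all of it leads away from
    [a]. *)
Lemma tree_dist_through a o u y : e o u ->
  (tree_dist e a o < tree_dist e a u)%N ->
  (tree_dist e y u < tree_dist e y o)%N ->
  tree_dist e a y = (tree_dist e a o + tree_dist e o y)%N.
Proof.
move=> eou lt_ou lt_uo.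
have := simple_path_rev (simple_path_rcons eou lt_uo).
rewrite belast_rcons lastI rev_rcons; have [_ _ ->] := geodesicP y u => S.
by rewrite (simple_path_away S lt_ou) (tree_distE S).
Qed.

Lemma exists_closer_adj a x : x != a -> exists y p,
  [/\ simple_path x (y :: p) a, e x y &
      tree_dist e a x = (tree_dist e a y).+1].
Proof.
move=> xa; have := geodesicP x a.
case: (geodesic e x a) => [[_ _ /= E]|y p S]; first by rewrite E eqxx in xa.
have [_ S'] := @simple_path_cat x [:: y] p a S.
exists y, p; split=> //; first by case: S => /= /andP[].
by rewrite !(tree_distC a) (tree_distE S) (tree_distE S').
Qed.

(* The geodesic from x to a starts at y: were y further from o, every later
   vertex of it would be even further. *)
Lemma closer_adj_ball o N a x y : e x y ->
  (tree_dist e a y < tree_dist e a x)%N -> (tree_dist e o a <= N)%N ->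
  (tree_dist e o x <= N)%N -> (tree_dist e o y <= N)%N.
Proof.
move=> exy lt_yx oa ox; have xa : x != a.
  by apply: contraTneq lt_yx => ->; rewrite tree_distxx.
have [z [p [S exz E]]] := exists_closer_adj xa.
have -> : y = z by apply: (closer_adj_unique exy exz lt_yx); rewrite E.
case: (tree_dist_adj o exz) => [oz|/eqP]; last first.
  by rewrite eq_sym => /eqP E'; apply: leq_trans ox; rewrite -E'.
have := simple_path_away (a := o) S; rewrite oz leqnn => /(_ isT) E'.
by rewrite E' in oa; apply: leq_trans oa; rewrite addnS ltnS leq_addr.
Qed.

Lemma finite_ball o n :
  exists s : seq V, forall x, (tree_dist e o x <= n)%N -> x \in s.
Proof.
elim: n => [|n [s hs]].
  by exists [:: o] => x; rewrite leqn0 tree_dist_eq0 inE eq_sym.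
pose nbr x := sval (cid (tree_degree he x)).
have nbrE x y : e x y = (y \in nbr x).
  by rewrite /nbr; case: cid => /= t [].
exists (o :: flatten [seq nbr x | x <- s]) => x ox.
have [->|xo] := eqVneq x o; first by rewrite mem_head.
have [y [p [_ exy E]]] := exists_closer_adj xo.
rewrite inE (negPf xo); apply/flattenP; exists (nbr y).
  by apply/map_f/hs; rewrite -ltnS -E.
by rewrite -nbrE (tree_sym he).
Qed.

End SimplePaths.

(** * Sums over neighbours in the finite tree *)

Lemma finite_tree_enum (V : choiceType) (q : nat) (e : rel V)
    (he : is_homogeneous_tree q e) (o : V) (N : nat) :
  exists T : seq (finite_tree e o N), uniq T /\ forall x, x \in T.
Proof.
have [s hs] := finite_ball he o N.
exists (undup (pmap insub s)); split; first exact: undup_uniq.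
by move=> x; rewrite mem_undup mem_pmap_sub hs //; case: x.
Qed.

Section FiniteTree.
Context {V : choiceType} (q : nat) {e : rel V} (he : is_homogeneous_tree q e).
Context {o : V} {N : nat} (hN : (0 < N)%N).
Context {T : seq (finite_tree e o N)} (uT : uniq T) (hT : forall x, x \in T).
Implicit Types (x y a : finite_tree e o N).

Definition degree x : nat := if (level x < N)%N then q.+1 else 1.

Lemma degree_gt0 x : (0 < degree x)%N.
Proof. by rewrite /degree; case: ifP. Qed.

Lemma level_le x : (level x <= N)%N. Proof. by case: x. Qed.

Lemma dist_adj a x y : adj x y ->
  dist a y = (dist a x).+1 \/ dist a x = (dist a y).+1.
Proof. exact: (tree_dist_adj he). Qed.

Lemma distC a x : dist a x = dist x a. Proof. exact: (tree_distC he). Qed.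

Lemma distxx x : dist x x = 0%N. Proof. exact: (tree_distxx he). Qed.

Lemma dist_eq0 x y : (dist x y == 0%N) = (x == y).
Proof. by rewrite /dist (tree_dist_eq0 he). Qed.

Lemma closer_adj a x : x != a -> exists y, [/\ adj x y,
  dist a x = (dist a y).+1 &
  forall z, adj x z -> z != y -> dist a z = (dist a x).+1].
Proof.
move=> xa.
have [|y [p [_ exy E]]] := @exists_closer_adj _ _ _ he (val a) (val x).
  by rewrite (inj_eq val_inj).
have ltyx : (tree_dist e (val a) y < tree_dist e (val a) (val x))%N.
  by rewrite E.
have yN := closer_adj_ball he exy ltyx (level_le a) (level_le x).
exists (Sub y yN); split; rewrite /adj /dist ?SubK //.
move=> z exz zy; case: (tree_dist_adj he (val a) exz) => // Ez.
case/eqP: zy; apply: val_inj; rewrite SubK.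
by apply: (closer_adj_unique he exz exy) ltyx; rewrite Ez.
Qed.

(** An inner vertex keeps all its neighbours. At level [N] every neighbour but the one towards the
    root would have level [N + 1]; as [0 < N], such a vertex is not the root. *)
Lemma count_adj x : count (adj x) T = degree x.
Proof.
rewrite -size_filter /degree; case: ltnP => [xN|xN].
  have [s [us <- sE]] := tree_degree he (val x).
  rewrite -(size_map val); apply/perm_size/uniq_perm => //.
    by rewrite (map_inj_uniq val_inj) filter_uniq.
  move=> y; rewrite -sE; apply/mapP/idP => [[z + ->]|exy].
    by rewrite mem_filter => /andP[].
  have yN : (tree_dist e o y <= N)%N.
    case: (tree_dist_adj he o exy) => [->//|].
    by move=> E; apply: leq_trans (ltnW xN); rewrite /level /dist /= E.
  exists (Sub y yN : finite_tree e o N); last by rewrite SubK.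
  by rewrite mem_filter hT andbT /adj SubK.
have xr : x != tree_root.
  by rewrite -dist_eq0 distC -lt0n; apply: leq_trans xN.
have [y [exy E far]] := closer_adj xr.
rewrite -[RHS]/(size [:: y]); apply/perm_size/uniq_perm => //.
  exact: filter_uniq.
move=> z; rewrite mem_filter hT andbT inE; apply/idP/eqP => [exz|->//].
apply: contraTeq (level_le z) => zy.
by rewrite -ltnNge /level (far _ exz zy) ltnS.
Qed.

Lemma sum_adj_const (M : nmodType) (c : M) x :
  \sum_(y <- T | adj x y) c = c *+ degree x.
Proof. by rewrite big_const_seq count_adj iter_addr_0. Qed.

Lemma sum_adj_dist_self (M : nmodType) (F : nat -> M) a :
  \sum_(y <- T | adj a y) F (dist a y) = F 1%N *+ degree a.
Proof.
rewrite -sum_adj_const; apply: eq_bigr => y ay.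
by rewrite /dist (tree_dist_adj1 he).
Qed.

Lemma sum_adj_dist (M : nmodType) (F : nat -> M) a x : x != a ->
  \sum_(y <- T | adj x y) F (dist a y) =
  F (dist a x).-1 + F (dist a x).+1 *+ (degree x).-1.
Proof.
move=> /closer_adj[y [xy E far]].
rewrite -big_filter (big_rem y) ?mem_filter ?xy ?hT //=; congr (_ + _).
  by rewrite E.
rewrite (eq_big_seq (fun=> F (dist a x).+1)) => [|z]; last first.
  rewrite mem_rem_uniq ?filter_uniq // inE mem_filter => /and3P[zy xz _].
  by rewrite far.
rewrite big_const_seq iter_addr_0 count_predT size_rem ?mem_filter ?xy ?hT //.
by rewrite size_filter count_adj.
Qed.

End FiniteTree.

(** * Finite Markov chains *)

Lemma first_time_ltP (R : realType) (d : measure_display)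
    (Omega : measurableType d) (S : Type) (X : nat -> Omega -> S)
    (k l : nat) (Z A : set S) (w : Omega) :
  ((first_time_from k X Z w : \bar R) < first_time_from l X A w)%E <->
  exists n, [/\ (k <= n)%N, Z (X n w) &
    forall m, (l <= m <= n)%N -> ~ A (X m w)].
Proof.
split.
  move=> /ereal_inf_lt[_ [n [kn Zn] <-] ltn].
  exists n; split=> // m /andP[lm mn] Am.
  have : ((first_time_from l X A w : \bar R) <= m%:R%:E)%E.
    by apply: ereal_inf_lbound; exists m.
  by move=> /(lt_le_trans ltn); rewrite lte_fin ltr_nat ltnNge mn.
move=> [n [kn Zn nA]].
apply: (@le_lt_trans _ _ n%:R%:E); first by apply: ereal_inf_lbound; exists n.
(* Every visit to [A] from time [l] on happens after [n], so [n + 1] bounds the second infimum from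
   below, even when it is infinite. *)
apply: (@lt_le_trans _ _ n.+1%:R%:E); first by rewrite lte_fin ltr_nat.
apply: le_ereal_inf_tmp => _ [m [lm Am] <-]; rewrite lee_fin ler_nat ltnNge.
by apply/negP => mn; apply: (nA m); rewrite ?lm.
Qed.

Section FiniteChain.
Context {R : realType} {d : measure_display} {Omega : measurableType d}.
Context {S : choiceType} {T : seq S} (uT : uniq T) (hT : forall x, x \in T).
Context {P : probability Omega R} {X : nat -> Omega -> S} {p : S -> S -> R}.
Context {a : S} (hX : is_markov_chain P X p a).
Implicit Types (C : nat -> set S) (E D : set Omega) (x y : S).

Definition pr E : R := fine (P E).

Lemma prK E : measurable E -> P E = (pr E)%:E.
Proof. by move=> mE; rewrite fineK // fin_num_measure. Qed.

Lemma pr_ge0 E : 0 <= pr E.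
Proof. exact/fine_ge0/measure_ge0. Qed.

Lemma preimage_bigcup n (A : set S) : X n @^-1` A =
  \bigcup_(x in [set` [seq x <- T | x \in A]]) (X n @^-1` [set x]).
Proof.
apply/seteqP; split=> [w Aw|w [x /=]].
  by exists (X n w) => //=; rewrite mem_filter hT andbT; exact: mem_set.
by rewrite mem_filter => /andP[/set_mem Ax _] ->.
Qed.

Lemma measurable_state n (A : set S) : measurable (X n @^-1` A).
Proof.
rewrite preimage_bigcup; apply: fin_bigcup_measurable; first exact: finite_seq.
by move=> x _; exact: (chain_measurable hX).
Qed.

Lemma pr_state_sum n (A : set S) E : measurable E ->
  pr (E `&` X n @^-1` A) =
  \sum_(x <- T | x \in A) pr (E `&` X n @^-1` [set x]).
Proof.
move=> mE; apply: EFin_inj; rewrite -prK; last first.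
  by apply: measurableI => //; exact: measurable_state.
rewrite preimage_bigcup setI_bigcupr measure_fin_bigcup.
- rewrite -fsbig_seq ?filter_uniq // big_filter -sumEFin.
  apply: eq_bigr => x _; apply: prK; apply: measurableI => //.
  exact: (chain_measurable hX).
- exact: finite_seq.
- by move=> x y _ _ [w /= [[_ <-] [_ <-]]].
- by move=> x _; apply: measurableI => //; exact: (chain_measurable hX).
Qed.

Definition window (l u : nat) (z : nat -> S) : set Omega :=
  [set w | forall i, (l <= i <= u)%N -> X i w = z i].

(* Events whose conditioning does not spoil the Markov property from time n
   on. *)
Definition markov_event n D := measurable D /\
  forall u z, (n <= u)%N ->
    pr (D `&` window n u.+1 z) = pr (D `&` window n u z) * p (z u) (z u.+1).

Lemma measurable_window l u z : measurable (window l u z).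
Proof.
have -> : window l u z =
    \bigcap_(i in [set i | (l <= i <= u)%N]) (X i @^-1` [set z i]).
  by apply/seteqP; split.
by apply: bigcap_measurableType => i _; exact: measurable_state.
Qed.

Lemma markov_event0 : markov_event 0 setT.
Proof.
split=> // u z _; rewrite !setTI; apply: EFin_inj.
rewrite EFinM -!prK; try exact: measurable_window.
have E v : window 0 v z =
    \bigcap_(i in [set i | (i <= v)%N]) (X i @^-1` [set z i]).
  by apply/seteqP; split.
by rewrite !E (chain_step hX).
Qed.

Lemma markov_eventS n D (A : set S) : markov_event n D ->
  markov_event n.+1 (D `&` X n @^-1` A).
Proof.
move=> [mD MD]; split.
  by apply: measurableI => //; exact: measurable_state.
move=> u z nu.
(* Fixing the state [x] at time [n] turns the condition [A] into windows that open at [n], where the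
   property of [D] applies. *)
have split_first v : (n < v)%N ->
    pr (D `&` X n @^-1` A `&` window n.+1 v z) =
    \sum_(x <- T | x \in A)
       pr (D `&` window n v (fun i => if i == n then x else z i)).
  move=> nv; rewrite setIAC pr_state_sum; last first.
    by apply: measurableI => //; exact: measurable_window.
  apply: eq_bigr => x _; congr pr; rewrite -setIA; congr setI.
  apply/seteqP; split=> w /=.
    move=> [W Xn] i /andP[]; rewrite leq_eqVlt => /orP[/eqP<- _|ni iv].
      by rewrite eqxx.
    by rewrite gtn_eqF // W // ni.
  move=> W; split; last by rewrite W ?eqxx // leqnn ltnW.
  move=> i /andP[ni iv]; rewrite W ?(ltnW ni) ?iv //.
  by rewrite gtn_eqF.
rewrite !split_first ?(leqW nu) // mulr_suml; apply: eq_bigr => x _.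
by rewrite (MD _ _ (ltnW nu)) !gtn_eqF // ltnW.
Qed.

Definition history C n : set Omega :=
  [set w | forall i, (i < n)%N -> C i (X i w)].

Lemma historyS C n : history C n.+1 = history C n `&` X n @^-1` C n.
Proof.
apply/seteqP; split=> w /=; first by move=> H; split=> [i /ltnW|]; apply: H.
by move=> [H Cn] i; rewrite ltnS leq_eqVlt => /orP[/eqP->|/H].
Qed.

Lemma history_markov C n : markov_event n (history C n).
Proof.
elim: n => [|n IH]; last by rewrite historyS; exact: markov_eventS.
have -> : history C 0 = setT by apply/seteqP; split.
exact: markov_event0.
Qed.

(** The law at time [n] of the chain killed on leaving [C]; the state at time [n] itself is not
    tested yet. *)
Definition occupation C n x : R := pr (history C n `&` X n @^-1` [set x]).

Lemma occupation_ge0 C n x : 0 <= occupation C n x.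
Proof. exact: pr_ge0. Qed.

Lemma occupationS C n y : occupation C n.+1 y =
  \sum_(x <- T | x \in C n) occupation C n x * p x y.
Proof.
have [mH MH] := history_markov C n.
rewrite /occupation historyS setIAC pr_state_sum; last first.
  by apply: measurableI => //; exact: measurable_state.
apply: eq_bigr => x _.
pose z i := if i == n then x else y.
have zn : z n = x by rewrite /z eqxx.
have zS : z n.+1 = y by rewrite /z gtn_eqF.
have := MH n z (leqnn n); rewrite zn zS.
have -> : window n n z = X n @^-1` [set x].
  apply/seteqP; split=> w /= H; first by rewrite H ?leqnn.
  by move=> i; rewrite -eqn_leq => /eqP <-; rewrite H.
have -> : window n n.+1 z = X n.+1 @^-1` [set y] `&` X n @^-1` [set x].
  apply/seteqP; split=> w /= H; first by split; rewrite H ?leqnn ?leqnSn.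
  move=> i /andP[ni]; rewrite leq_eqVlt => /orP[/eqP->|ltin].
    by rewrite zS; case: H.
  have -> : i = n by apply/eqP; rewrite eqn_leq ni -ltnS ltin.
  by rewrite zn; case: H.
by rewrite setIA.
Qed.

Lemma occupation_sumS C n (f : S -> R) :
  \sum_(y <- T) occupation C n.+1 y * f y =
  \sum_(x <- T | x \in C n) occupation C n x * \sum_(y <- T) p x y * f y.
Proof.
under eq_bigr do rewrite occupationS mulr_suml.
rewrite exchange_big /=; apply: eq_bigr => x _.
by rewrite mulr_sumr; apply: eq_bigr => y _; rewrite mulrA.
Qed.

Lemma not_start0 : P (~` (X 0 @^-1` [set a])) = 0%E.
Proof.
have ma := chain_measurable hX 0 a.
by rewrite probability_setC // (chain_start hX) subee.
Qed.

Lemma pr_start x : pr (X 0 @^-1` [set x]) = (x == a)%:R.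
Proof.
have Pa : pr (X 0 @^-1` [set a]) = 1 by rewrite /pr (chain_start hX).
have [->//|xa] := eqVneq x a.
have ma := chain_measurable hX 0 a.
rewrite /pr (@subset_measure0 _ _ _ P _ _ _ _ _ not_start0) //.
- exact: measurable_state.
- exact: measurableC.
- by move=> w /= -> /eqP; rewrite (negPf xa).
Qed.

(** * Hitting probabilities from a harmonic function *)

Section HarmonicFunction.
Context {Z : set S} (aZ : ~ Z a) {f g : S -> R}.
Context (fa : f a = 0) (fZ : forall x, Z x -> f x = 1).
Context (f_harmonic : forall x, x != a -> ~ Z x ->
  \sum_(y <- T) p x y * f y = f x).
Context (g_ge0 : forall x, 0 <= g x).
Context (g_drift : forall x, x != a -> ~ Z x ->
  \sum_(y <- T) p x y * g y <= g x - 1).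

(** The sets depend on time because [a] is the required state at time 0 and forbidden, like [Z],
    from time 1 on. *)
Let C n : set S := if n is _.+1 then ~` (a |` Z) else [set a].
Let u := occupation C.

Let reach := \sum_(y <- T) p a y * f y.

(** The first visit to [Z] happens at time [n + 1], with no earlier return to [a]. *)
Let hit n := pr (history C n.+1 `&` X n.+1 @^-1` Z).

Let sum_u1 (h : S -> R) :
  \sum_(y <- T) u 1 y * h y = \sum_(y <- T) p a y * h y.
Proof.
rewrite occupation_sumS (big_rem a) //= mem_set // [X in _ + X]big1_seq.
  rewrite addr0 /occupation.
  have -> : history C 0 = setT by apply/seteqP; split.
  by rewrite setTI pr_start eqxx mul1r.
move=> x /andP[/set_mem/= -> /[!mem_rem_uniq]//].
by rewrite !inE eqxx.
Qed.

Let C_out n x : x \in C n.+1 -> x != a /\ ~ Z x.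
Proof.
by move=> /set_mem /= /not_orP[xa xZ]; split=> //; apply/eqP.
Qed.

Let hit_sum n : hit n = \sum_(x <- T | x \in Z) u n.+1 x.
Proof. by apply: pr_state_sum; have [] := history_markov C n.+1. Qed.

(** The mass in [Z] carries [f = 1] and is what [hit n] counts, the mass at [a] carries [f = 0], and
    harmonicity preserves the mean over the rest. *)
Let f_step n : \sum_(y <- T) u n.+2 y * f y =
  \sum_(y <- T) u n.+1 y * f y - hit n.
Proof.
rewrite occupation_sumS hit_sum big_mkcond [X in _ - X]big_mkcond -sumrB.
apply: eq_bigr => x _; have [xC|xC] := boolP (x \in C n.+1).
  have [xa xZ] := C_out xC.
  by rewrite f_harmonic // memNset // subr0.
have [xZ|xZ] := boolP (x \in Z).
  by rewrite fZ ?mulr1 ?subrr //; exact: set_mem.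
suff -> : x = a by rewrite fa mulr0 subr0.
apply: contrapT => xa; move/negP: xC; apply; apply: mem_set => -[//|/mem_set].
exact/negP.
Qed.

Let hit_partial n :
  \sum_(0 <= i < n) hit i = reach - \sum_(y <- T) u n.+1 y * f y.
Proof.
elim: n => [|n IH]; first by rewrite big_nil sum_u1 subrr.
by rewrite big_nat_recr //= IH f_step opprB addrA addrAC.
Qed.

Let alive n := \sum_(x <- T | x \in C n.+1) u n.+1 x.

Let alive_ge0 n : 0 <= alive n.
Proof. by apply: sumr_ge0 => x _; exact: occupation_ge0. Qed.

Let alive_step n : \sum_(y <- T) u n.+2 y * g y <=
  \sum_(y <- T) u n.+1 y * g y - alive n.
Proof.
rewrite occupation_sumS /alive big_mkcond [X in _ - X]big_mkcond -sumrB.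
apply: ler_sum => x _; have [xC|xC] := boolP (x \in C n.+1).
  have [xa xZ] := C_out xC; rewrite -[X in _ - X]mulr1 -mulrBr.
  by rewrite ler_wpM2l ?occupation_ge0 // g_drift.
by rewrite subr0 mulr_ge0 // occupation_ge0.
Qed.

(** Each step lowers the mean of [g] by at least [alive n], and this mean stays nonnegative. *)
Let alive_partial n :
  \sum_(0 <= i < n) alive i <= \sum_(y <- T) u 1 y * g y.
Proof.
suff : \sum_(0 <= i < n) alive i <=
    \sum_(y <- T) u 1 y * g y - \sum_(y <- T) u n.+1 y * g y.
  move/le_trans; apply; rewrite gerBl; apply: sumr_ge0 => x _.
  by rewrite mulr_ge0 // occupation_ge0.
elim: n => [|n IH]; first by rewrite big_nil subrr.
by rewrite big_nat_recr //=; have := alive_step n; lra.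
Qed.

Let alive_cvg : alive @ \oo --> 0.
Proof.
apply: cvg_series_cvg_0; apply: nondecreasing_is_cvgn.
  apply/nondecreasing_seqP => n; rewrite /series /= big_nat_recr //=.
  by rewrite lerDl.
by exists (\sum_(y <- T) u 1 y * g y) => _ [n _ <-]; exact: alive_partial.
Qed.

(** By harmonicity the mean at time [n + 2] is the mean of [f] over the mass alive at time [n + 1],
    and [f] is bounded since there are finitely many states. *)
Let f_cvg : (fun n => \sum_(y <- T) u n.+2 y * f y) @ \oo --> 0.
Proof.
pose K : R := \sum_(y <- T) `|f y|.
have fK x : `|f x| <= K.
  rewrite /K (big_rem x) //= lerDl; apply: sumr_ge0 => *; exact: normr_ge0.
have bound n : `|\sum_(y <- T) u n.+2 y * f y| <= alive n * K.
  rewrite occupation_sumS /alive mulr_suml.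
  apply: le_trans (ler_norm_sum _ _ _) _; apply: ler_sum => x xC.
  have [xa xZ] := C_out xC; rewrite f_harmonic // normrM.
  by rewrite ger0_norm ?occupation_ge0 // ler_wpM2l // occupation_ge0.
apply/norm_cvg0P.
have := cvgM alive_cvg (cvg_cst (K : R)); rewrite mul0r => aK.
apply: (squeeze_cvgr _ (cvg_cst (0 : R))); last exact: aK.
by near=> n; rewrite /= normr_ge0 bound.
Unshelve. all: by end_near.
Qed.

Let hit_trivIset :
  trivIset setT (fun n => history C n.+1 `&` X n.+1 @^-1` Z).
Proof.
have disj i j : (i < j)%N -> forall w, history C j.+1 w -> ~ Z (X i.+1 w).
  by move=> ij w /(_ i.+1); rewrite ltnS => /(_ ij) /= /not_orP[].
move=> i j _ _ [w [[/= Hi Zi] [/= Hj Zj]]].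
case: (ltngtP i j) => // ij; exfalso.
  exact: (disj _ _ ij w Hj Zi).
exact: (disj _ _ ij w Hi Zj).
Qed.

(** The starting event is intersected in because the chain starts at [a] only almost surely. *)
Let reach_setE :
  [set w | (hitting_time X Z w < (return_time X a w : \bar R))%E]
    `&` X 0 @^-1` [set a] =
  \bigcup_n (history C n.+1 `&` X n.+1 @^-1` Z).
Proof.
apply/seteqP; split=> w /=.
  move=> [/first_time_ltP[n [_ Zn Na]] X0].
  have exZ : exists n, `[<Z (X n w)>] by exists n; exact: asboolT.
  (* The first visit to [Z]; its time is not 0 because [a] is outside [Z]. *)
  have [k Zk kmin] := ex_minnP exZ.
  have lekn : (k <= n)%N by apply: kmin; exact: asboolT.
  case: k Zk kmin lekn => [/asboolP|k /asboolP Zk kmin lekn].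
    by rewrite X0.
  exists k => //; split=> // -[_ //|i] ik [Xa|Zi].
    by apply: (Na i.+1) => //; rewrite (leq_trans (ltnW ik)).
  by have := kmin i.+1 (asboolT Zi); rewrite leqNgt ik.
move=> [n _ [H Zn]]; split; last exact: (H 0).
apply/first_time_ltP; exists n.+1; split=> // -[//|m].
rewrite /= ltnS leq_eqVlt => /orP[/eqP-> Xa|mn Xa].
  by apply: aZ; rewrite -Xa.
by apply: (H m.+1); [rewrite ltnS | left].
Qed.

Let measurable_reach :
  measurable [set w | (hitting_time X Z w < (return_time X a w : \bar R))%E].
Proof.
have -> : [set w | (hitting_time X Z w < (return_time X a w : \bar R))%E] =
    \bigcup_n (X n @^-1` Z `&`
      \bigcap_(m in [set m | (1 <= m <= n)%N]) (X m @^-1` (~` [set a]))).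
  apply/seteqP; split=> w /=.
    by move=> /first_time_ltP[n [_ Zn Na]]; exists n.
  by move=> [n _ [Zn Na]]; apply/first_time_ltP; exists n.
apply: bigcupT_measurable => n; apply: measurableI.
  exact: measurable_state.
by apply: bigcap_measurableType => m _; exact: measurable_state.
Qed.

Lemma reach_prob_harmonic :
  P [set w | (hitting_time X Z w < (return_time X a w : \bar R))%E] =
  (\sum_(y <- T) p a y * f y)%:E.
Proof.
have mhit n : measurable (history C n.+1 `&` X n.+1 @^-1` Z).
  apply: measurableI; last exact: measurable_state.
  by have [] := history_markov C n.+1.
have ma := chain_measurable hX 0 a.
have -> : P [set w | (hitting_time X Z w < (return_time X a w : \bar R))%E] =
    P (\bigcup_n (history C n.+1 `&` X n.+1 @^-1` Z)).
  (* The part of the event where the chain does not start at [a] is null. *)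
  rewrite -reach_setE (measureDI P measurable_reach ma).
  rewrite [X in (X + _)%E](_ : _ = 0%E) ?add0e //.
  apply: (@subset_measure0 _ _ _ P _ (~` (X 0 @^-1` [set a]))).
  - exact: measurableD.
  - exact: measurableC.
  - by move=> w [].
  - exact: not_start0.
apply: (@cvg_unique _ (@ereal_hausdorff R) _ _ _ _
  (@measure_sigma_additive _ _ _ P _ mhit hit_trivIset)).
rewrite (_ : (fun n => _) =
    EFin \o (fun n => \sum_(0 <= i < n) hit i)); last first.
  by apply/funext => n /=; rewrite -sumEFin; apply: eq_bigr => i _; exact: prK.
apply: cvg_EFin; first by near=> n.
rewrite (_ : _ \o _ =
    fun n => reach - \sum_(y <- T) u n.+1 y * f y); last first.
  by apply/funext => n /=; exact: hit_partial.
rewrite -[X in _ --> X]subr0; apply: cvgB; first exact: cvg_cst.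
by rewrite -cvg_shiftS.
Unshelve. all: by end_near.
Qed.

End HarmonicFunction.
End FiniteChain.

(** * The walk on the finite tree *)

Section Walk.
Context {R : realType} {V : choiceType} {q : nat} {e : rel V}.
Context (he : is_homogeneous_tree q e) {o : V} {N : nat} (hN : (0 < N)%N).
Context {T : seq (finite_tree e o N)} (uT : uniq T) (hT : forall x, x \in T).
Implicit Types (x y a : finite_tree e o N) (f : finite_tree e o N -> R).

Let deg x : nat := degree q x.

Lemma walk_sum f x : \sum_(y <- T) walk_transition R q x y * f y =
  (deg x)%:R^-1 * \sum_(y <- T | adj x y) f y.
Proof.
rewrite mulr_sumr [RHS]big_mkcond; apply: eq_bigr => y _.
rewrite /walk_transition /deg /degree; case: ifP => _; last by rewrite mul0r.
by case: ifP => // _; rewrite invr1.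
Qed.

Lemma walk_drift a : exists g : finite_tree e o N -> R,
  (forall x, 0 <= g x) /\
  forall x, x != a -> \sum_(y <- T) walk_transition R q x y * g y <= g x - 1.
Proof.
pose M := \max_(y <- T) dist a y.
have leM y : (dist a y <= M)%N by apply: leq_bigmax_seq.
pose r : R := 2 * q.+1%:R.
have q1 : 1 <= q.+1%:R :> R by rewrite ler1n.
have r1 : 1 <= r by rewrite /r; lra.
pose G k : R := r ^+ M - r ^+ (M - k).
have G_ge0 k : 0 <= G k by rewrite subr_ge0 ler_weXn2l // leq_subr.
have GM k : G k <= r ^+ M by rewrite gerBl exprn_ge0 // (le_trans ler01).
exists (fun y => G (dist a y)); split=> // x xa.
rewrite walk_sum (sum_adj_dist he hN uT hT) //.
have k0 : (0 < dist a x)%N by rewrite lt0n (dist_eq0 he) eq_sym.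
have kM := leM x.
(* For the nearer neighbour the exponent grows by exactly one, as [0 < dist a x <= M]. For the
   others the crude bound [G <= r ^+ M] suffices, even where the subtraction truncates. *)
have -> : G (dist a x).-1 = r ^+ M - r * r ^+ (M - dist a x).
  rewrite /G -exprS; congr (_ - _ ^+ _).
  by case: (dist a x) k0 kM => // k _ /subnSK.
have l1 : 1 <= r ^+ (M - dist a x) by rewrite exprn_ege1.
rewrite /(G (dist a x)); move: l1 (GM (dist a x).+1).
set l := r ^+ (M - _); set L := r ^+ M => l1 GL.
have dq : (deg x)%:R <= q.+1%:R :> R.
  by rewrite ler_nat /deg /degree; case: ifP.
have [d dE] : exists d, deg x = d.+1.
  by exists (deg x).-1; rewrite prednK // degree_gt0.
rewrite -/(deg x) dE /= mulrC ler_pdivrMr ?ltr0n //.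
rewrite -mulr_natr.
have d0 : 0 <= d%:R :> R by [].
have G2 : G (dist a x).+1 * d%:R <= L * d%:R by rewrite ler_wpM2r.
move: dq; rewrite dE -!natr1 /r -natr1 => dq.
(* After these bounds the drift inequality amounts to [deg x * (l + 1) <= r * l]. It follows from
   [deg x <= q + 1] and [1 <= l], which explains the factor 2 in [r]. *)
have : (d%:R + 1) * (l + 1) <= 2 * (q%:R + 1) * l by nra.
nra.
Qed.

(** * Hitting probabilities of the walk *)

Context {d : measure_display} {Omega : measurableType d}.
Context {P : finite_tree e o N -> probability Omega R}.
Context {X : nat -> Omega -> finite_tree e o N}.

Lemma walk_reach_prob f a (Z : set (finite_tree e o N)) :
  is_markov_chain (P a) X (walk_transition R q) a ->
  f a = 0 -> (forall x, Z x -> f x = 1) ->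
  (forall x, x != a -> ~ Z x -> \sum_(y <- T | adj x y) f y = f x *+ deg x) ->
  reach_prob P X a Z =
  ((deg a)%:R^-1 * \sum_(y <- T | adj a y) f y)%:E.
Proof.
move=> hX fa fZ f_harm; have [g [g_ge0 g_drift]] := walk_drift a.
have aZ : ~ Z a by move=> /fZ; rewrite fa => /esym/eqP; rewrite oner_eq0.
rewrite -walk_sum /reach_prob.
apply: (reach_prob_harmonic uT hT hX aZ fa fZ _ g_ge0) => [x xa xZ|x xa _].
  rewrite walk_sum f_harm // -[f x *+ _]mulr_natl mulKf //.
  by rewrite pnatr_eq0 -lt0n degree_gt0.
exact: g_drift.
Qed.

(* Up to the factor d(a, b), the projection of x onto the geodesic from a to b,
   expressed as a Gromov product. *)
Definition potential a b x : R :=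
  ((dist a b)%:R + (dist a x)%:R - (dist b x)%:R) / (2 * (dist a b)%:R).

Lemma potential_start a b : potential a b a = 0.
Proof. by rewrite /potential (distxx he) (distC he b a) addr0 subrr mul0r. Qed.

Lemma potential_end a b x : a != b -> dist a x = (dist a b + dist b x)%N ->
  potential a b x = 1.
Proof.
move=> ab E; rewrite /potential E natrD.
have : (dist a b)%:R != 0 :> R by rewrite pnatr_eq0 (dist_eq0 he).
by move=> ?; field.
Qed.

Lemma potential_sum a b x : \sum_(y <- T | adj x y) potential a b y =
  ((dist a b)%:R *+ deg x + \sum_(y <- T | adj x y) (dist a y)%:R -
   \sum_(y <- T | adj x y) (dist b y)%:R) / (2 * (dist a b)%:R).
Proof.
by rewrite -mulr_suml sumrB big_split /= (sum_adj_const he hN uT hT).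
Qed.

Lemma natr_sum_adj_dist a x : x != a ->
  \sum_(y <- T | adj x y) (dist a y)%:R =
  (dist a x)%:R *+ deg x + (deg x)%:R - 2 :> R.
Proof.
move=> xa; rewrite (sum_adj_dist he hN uT hT (fun k => k%:R)) // -/(deg x).
have : (0 < dist a x)%N by rewrite lt0n (dist_eq0 he) eq_sym.
have : (0 < deg x)%N := degree_gt0 q x.
case: (dist a x) (deg x) => // k [//|n] _ _ /=.
rewrite -[k.+2%:R *+ n]mulr_natr -[k.+1%:R *+ n.+1]mulr_natr -!natr1; ring.
Qed.

Lemma potential_harmonic a b x : x != a -> x != b ->
  \sum_(y <- T | adj x y) potential a b y = potential a b x *+ deg x.
Proof.
move=> xa xb; rewrite potential_sum !natr_sum_adj_dist // /potential.
rewrite -[_ *+ deg x in RHS]mulr_natr.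
rewrite -![_%:R *+ deg x]mulr_natr; ring.
Qed.

(** At [a] itself the distances to [a] sum to [deg a], with no neighbour nearer; compared with the
    sum for [b] this leaves a surplus of 2 in the numerator. *)
Lemma potential_flow a b : a != b ->
  \sum_(y <- T | adj a y) potential a b y = (dist a b)%:R^-1.
Proof.
move=> ab; rewrite potential_sum (natr_sum_adj_dist ab).
rewrite (sum_adj_dist_self he hN uT hT (fun k => k%:R)) -/(deg a).
rewrite (distC he b a).
have : (dist a b)%:R != 0 :> R by rewrite pnatr_eq0 (dist_eq0 he).
by move=> ?; rewrite -[_%:R *+ deg a]mulr_natr; field.
Qed.

(** The condition on distances says that every geodesic from [a] to [Z] passes through [b], so the
    potential is 1 on all of [Z]; as [b] is in [Z], it is harmonic off [a] and [Z]. *)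
Lemma reach_prob_potential a b (Z : set (finite_tree e o N)) :
  is_markov_chain (P a) X (walk_transition R q) a -> a != b -> Z b ->
  (forall x, Z x -> dist a x = (dist a b + dist b x)%N) ->
  reach_prob P X a Z = ((deg a)%:R^-1 * (dist a b)%:R^-1)%:E.
Proof.
move=> hX ab Zb hZ; rewrite (walk_reach_prob (f := potential a b) hX).
- by rewrite potential_flow.
- exact: potential_start.
- by move=> x /hZ; exact: potential_end.
- move=> x xa xZ; apply: potential_harmonic => //.
  by apply: contra_notN xZ => /eqP->.
Qed.

(** The neighbour [u] of the root that defines the subtree of [x] is nearer to [x] than the root is,
    but farther from [a]. *)
Lemma other_subtrees_through a x : a != tree_root -> other_subtrees a x ->
  dist a x = (dist a tree_root + dist tree_root x)%N.
Proof.
move=> ar [u [ou nua]] [->|]; first by rewrite (distxx he) addn0.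
rewrite (mem_geodesic_adj he) // => lt_uo.
apply: (tree_dist_through he ou) lt_uo.
case: (dist_adj he a ou) => [E|E]; first by rewrite /dist in E; rewrite E.
case: nua; right; rewrite (mem_geodesic_adj he) //.
by rewrite /dist in E; rewrite E.
Qed.

(** The root has at least two neighbours and only one of them is nearer to [a]; any other one spans
    a subtree that avoids [a]. *)
Lemma other_subtrees_root a : (0 < q)%N -> a != tree_root ->
  other_subtrees a tree_root.
Proof.
move=> q0 ar; have [|y [ry E far]] := @closer_adj _ _ _ he _ _ a tree_root.
  by rewrite eq_sym.
have [u ou uy] : exists2 u, adj tree_root u & u != y.
  apply: contrapT => nu.
  have := count_adj he hN uT hT tree_root.
  rewrite /degree (_ : level _ = 0)%N ?hN; last exact: (distxx he).
  have -> : count (adj tree_root) T = count (pred1 y) T.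
    apply: eq_count => u /=; apply/idP/eqP => [ou|->//].
    by apply: contrapT => /eqP uy; apply: nu; exists u.
  by rewrite (count_uniq_mem _ uT) hT; case: q q0.
exists u; last by left.
split=> // -[/eqP|]; first by rewrite (negPf ar).
rewrite (mem_geodesic_adj he) //; have := far _ ou uy; rewrite /dist => ->.
by rewrite ltnNge leqnSn.
Qed.

Lemma reach_prob_level n : (1 < q)%N -> (1 <= n <= N)%N ->
  is_markov_chain (P tree_root) X (walk_transition R q) tree_root ->
  reach_prob P X tree_root [set z | level z = n] =
  ((1 - q%:R^-1) / (1 - q%:R^-1 ^+ n))%:E.
Proof.
move=> q1 /andP[n0 nN] hX.
pose phi k : R := (1 - q%:R^-1 ^+ k) / (1 - q%:R^-1 ^+ n).
pose F k := phi (minn k n).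
have q0 : q%:R != 0 :> R by rewrite pnatr_eq0 -lt0n ltnW.
have phin : phi n = 1.
  rewrite /phi divff // subr_eq0 eq_sym lt_eqF // exprn_ilt1 -?lt0n //.
  by rewrite invf_lt1 ?ltr1n // ltr0n ltnW.
have rootF : \sum_(y <- T | adj tree_root y) F (level y) =
    phi 1 *+ deg tree_root.
  rewrite /level (sum_adj_dist_self he hN uT hT).
  by rewrite /F (minn_idPl n0).
rewrite (walk_reach_prob (f := fun y => F (level y)) hX).
- by rewrite rootF -[phi 1 *+ _]mulr_natl mulKf ?pnatr_eq0 -?lt0n ?degree_gt0.
- by rewrite /F /level (distxx he) min0n /phi expr0 subrr mul0r.
- by move=> x /= ->; rewrite /F minnn.
move=> x xr /= xn; rewrite /level (sum_adj_dist he hN uT hT) // -/(deg x).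
rewrite -/(level x).
have k0 : (0 < level x)%N by rewrite lt0n (dist_eq0 he) eq_sym.
have [xn'|nx] := ltnP (level x) n.
  (* Vertices below level [n] are inner, and there harmonicity is the identity [q^(-(k-1)) + q *
     q^(-(k+1)) = (q + 1) * q^(-k)]. *)
  have -> : deg x = q.+1 by rewrite /deg /degree (leq_trans xn' nN).
  rewrite /F (minn_idPl (ltnW xn')) (minn_idPl xn').
  rewrite (minn_idPl (leq_trans (leq_pred _) (ltnW xn'))) /phi.
  case: (level x) k0 => // k _ /=; rewrite !exprS.
  rewrite -[X in _ + X = _]mulr_natr -[RHS]mulr_natr.
  set w := _ ^+ k; set D := (1 - _ ^+ n)^-1; rewrite -natr1.
  by field.
(* Beyond level [n] the function is 1 at [x] and at all its neighbours, hence harmonic whatever the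
   degree. *)
have ltnx : (n < level x)%N by rewrite ltn_neqAle nx andbT; apply/eqP/nesym.
have Fn k : (n <= k)%N -> F k = 1 by rewrite /F => /minn_idPr->.
have le_pred : (n <= (level x).-1)%N by rewrite -ltnS prednK.
rewrite (Fn _ le_pred) (Fn _ nx) (Fn _ (leqW nx)).
by rewrite -mulrS prednK // degree_gt0.
Qed.

End Walk.

Theorem proposition7p4 (R : realType) (q N : nat) (hq : (2 <= q)%N)
  (hN : (1 <= N)%N)
  (V : choiceType) (e : rel V) (he : is_homogeneous_tree q e) (o : V)
  (d : measure_display) (Omega : measurableType d)
  (P : finite_tree e o N -> probability Omega R)
  (X : nat -> Omega -> finite_tree e o N)
  (hX : forall a : finite_tree e o N,
     is_markov_chain (P a) X (walk_transition R q) a) :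
  [/\ (* (a) *)
      forall n : nat, (1 <= n)%N -> (n <= N)%N ->
        reach_prob P X tree_root [set z | level z = n] =
        (q%:R ^+ n.-1 * ((q%:R - 1) / (q%:R ^+ n - 1)))%:E,
      (* (b) *)
      forall (n : nat) (a : finite_tree e o N), (1 <= n)%N -> N = n ->
        level a = n ->
        reach_prob P X a (other_subtrees a) = (1 / n%:R)%:E,
      (* (c) *)
      forall (n : nat) (a : finite_tree e o N), (1 <= n)%N -> (n < N)%N ->
        level a = n ->
        reach_prob P X a (other_subtrees a) = (1 / (n%:R * (q%:R + 1)))%:E,
      (* (d) *)
      forall a x : finite_tree e o N, terminal a -> x <> a ->
        reach_prob P X a [set x] = (1 / (dist a x)%:R)%:E
    & (* (e) *)
      forall a x : finite_tree e o N, ~ terminal a -> x <> a ->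
        reach_prob P X a [set x] = (1 / ((dist a x)%:R * (q%:R + 1)))%:E].
Proof.
have [T [uT hT]] := finite_tree_enum he o N.
have deg_inner (a : finite_tree e o N) : (level a < N)%N -> degree q a = q.+1.
  by rewrite /degree => ->.
have deg_terminal (a : finite_tree e o N) : terminal a -> degree q a = 1%N.
  by rewrite /degree /terminal => ->; rewrite ltnn.
(* Here the potential is taken with the root as its second pole. *)
have subtrees (n : nat) (a : finite_tree e o N) : (1 <= n)%N -> level a = n ->
    reach_prob P X a (other_subtrees a) =
    ((degree q a)%:R^-1 * (dist a tree_root)%:R^-1)%:E.
  move=> n1 an.
  have ar : a != tree_root.
    by apply: contraTneq n1 => ar; rewrite -an ar /level (distxx he).
  apply: (reach_prob_potential he hN uT hT (hX a) ar).
    exact: (other_subtrees_root he hN uT hT (ltnW hq) ar).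
  by move=> x; exact: (other_subtrees_through he ar).
have singleton (a x : finite_tree e o N) : x <> a ->
    reach_prob P X a [set x] = ((degree q a)%:R^-1 * (dist a x)%:R^-1)%:E.
  move=> xa; apply: (reach_prob_potential he hN uT hT (hX a)) => //.
    by apply/eqP/nesym.
  by move=> _ ->; rewrite (distxx he) addn0.
split.
- move=> n n1 nN; rewrite (reach_prob_level he hN uT hT) ?n1 //.
  (* Multiplying numerator and denominator by [q^n] gives the stated form. *)
  congr EFin; case: n n1 nN => // n _ _ /=; rewrite exprVn exprS.
  have q0 : q%:R != 0 :> R by rewrite pnatr_eq0 -lt0n ltnW.
  have qn0 : q%:R ^+ n != 0 :> R by rewrite expf_neq0.
  have qn1 : q%:R * q%:R ^+ n - 1 != 0 :> R.
    by rewrite -exprS subr_eq0 gt_eqF // exprn_egt1 // ltr1n.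
  by field; rewrite ?q0 ?qn0 ?qn1.
- move=> n a n1 Nn an; rewrite (subtrees n) // deg_terminal; last first.
    by rewrite /terminal an Nn.
  by rewrite invr1 !mul1r (distC he) -an.
- move=> n a n1 nN an; rewrite (subtrees n) // deg_inner ?an //.
  by rewrite (distC he) -an /level -natr1 mul1r invfM mulrC.
- by move=> a x at_ xa; rewrite singleton // deg_terminal // invr1 !mul1r.
- move=> a x a_inner xa; rewrite singleton // deg_inner.
    by rewrite -natr1 mul1r invfM mulrC.
  by rewrite ltn_neqAle level_le andbT; apply/eqP.
Qed.
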